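(* Let $\widetilde{s}_n$ be the number of unlabeled split graphs on $n$ vertices and let $\widetilde{b}_n$ be the number of unlabeled bicolored graphs on $n$ vertices. Then $\widetilde{s}_n\sim\widetilde{b}_n$, i.e. $\lim_{n\to\infty}\widetilde{s}_n/\widetilde{b}_n=1$.
   Context: Graphs are finite and simple. A split graph is a graph whose vertices can be partitioned into two (possibly empty) sets $K$ and $S$ such that $K$ is a clique and $S$ is a stable (independent) set. A bicolored graph is a graph in which each vertex is colored green or red such that no two adjacent vertices have the same color; the colors are not interchangeable, and isomorphisms of bicolored graphs are the graph isomorphisms that preserve color. Unlabeled split graphs are isomorphism classes of split graphs; unlabeled bicolored graphs are isomorphism classes of bicolored graphs under color-preserving isomorphism. *)

(* Defs.v *)
From mathcomp Require Import all_boot all_fingroup.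

Set Implicit Arguments.
Unset Strict Implicit.
Unset Printing Implicit Defensive.

(* A graph on the finite vertex type T is given by its adjacency relation,
   encoded as a finite function so that graphs on T form a finType. *)
Definition digraph (T : finType) : finType := {ffun T * T -> bool}.

Definition adj (T : finType) (G : digraph T) (x y : T) : bool := G (x, y).

Definition simple_graph (T : finType) (G : digraph T) : bool :=
  [forall x, ~~ adj G x x] && [forall x, forall y, adj G x y == adj G y x].

Definition clique (T : finType) (G : digraph T) (K : {set T}) : bool :=
  [forall x in K, forall y in K, (x != y) ==> adj G x y].

Definition stable_set (T : finType) (G : digraph T) (S : {set T}) : bool :=
  [forall x in S, forall y in S, ~~ adj G x y].

Definition split_graph (T : finType) (G : digraph T) : bool :=
  simple_graph G &&
  [exists K : {set T}, exists S : {set T},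
     [&& K :|: S == [set: T], K :&: S == set0,
         clique G K & stable_set G S]].

(* [p] is an isomorphism from [G] to [H]. *)
Definition is_iso (T : finType) (G H : digraph T) (p : {perm T}) : bool :=
  [forall x, forall y, adj H (p x) (p y) == adj G x y].

Definition graph_iso (T : finType) (G H : digraph T) : bool :=
  [exists p : {perm T}, is_iso G H p].

(* A graph together with a coloring of its vertices: [true] is green and
   [false] is red. *)
Definition colored_digraph (T : finType) : finType :=
  (digraph T * {ffun T -> bool})%type.

Definition bicolored_graph (T : finType) (B : colored_digraph T) : bool :=
  simple_graph B.1 &&
  [forall x, forall y, adj B.1 x y ==> (B.2 x != B.2 y)].

Definition bicolored_iso (T : finType) (B C : colored_digraph T) : bool :=
  [exists p : {perm T}, is_iso B.1 C.1 p && [forall x, C.2 (p x) == B.2 x]].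

(* Every graph on n vertices is isomorphic to one on 'I_n, so the unlabeled
   graphs on n vertices are the isomorphism classes of graphs on 'I_n. *)
Definition unlabeled_split_graphs (n : nat) : {set {set digraph 'I_n}} :=
  equivalence_partition (@graph_iso 'I_n) [set G | split_graph G].

Definition unlabeled_bicolored_graphs (n : nat) :
    {set {set colored_digraph 'I_n}} :=
  equivalence_partition (@bicolored_iso 'I_n) [set B | bicolored_graph B].

Definition num_split (n : nat) : nat := #|unlabeled_split_graphs n|.

Definition num_bicolored (n : nat) : nat := #|unlabeled_bicolored_graphs n|.

Lemma is_iso1 (T : finType) (G : digraph T) : is_iso G G 1%g.
Proof. by apply/forallP=> x; apply/forallP=> y; rewrite !perm1. Qed.

Lemma is_isoV (T : finType) (G H : digraph T) (p : {perm T}) :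
  is_iso G H p -> is_iso H G p^-1%g.
Proof.
move=> /forallP GH; apply/forallP=> x; apply/forallP=> y.
by have /forallP/(_ (p^-1%g y)) := GH (p^-1%g x); rewrite !permKV eq_sym.
Qed.

Lemma is_isoM (T : finType) (G H K : digraph T) (p q : {perm T}) :
  is_iso G H p -> is_iso H K q -> is_iso G K (p * q)%g.
Proof.
move=> /forallP GH /forallP HK; apply/forallP=> x; apply/forallP=> y.
have /forallP/(_ y)/eqP <- := GH x; have /forallP/(_ (p y)) := HK (p x).
by rewrite !permM.
Qed.

Lemma graph_iso_equiv (T : finType) : equivalence_rel (@graph_iso T).
Proof.
have sym (G H : digraph T) : graph_iso G H -> graph_iso H G.
  by case/existsP=> p /is_isoV GH; apply/existsP; exists p^-1%g.
have tr (G H K : digraph T) : graph_iso G H -> graph_iso H K -> graph_iso G K.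
  case/existsP=> p GH /existsP[q HK]; apply/existsP; exists (p * q)%g.
  exact: is_isoM GH HK.
move=> G H K; split; first by apply/existsP; exists 1%g; apply: is_iso1.
by move=> GH; apply/idP/idP; apply: tr => //; apply: sym.
Qed.

Lemma bicolored_iso_equiv (T : finType) : equivalence_rel (@bicolored_iso T).
Proof.
have sym (B C : colored_digraph T) : bicolored_iso B C -> bicolored_iso C B.
  case/existsP=> p /andP[/is_isoV BC /forallP cBC].
  apply/existsP; exists p^-1%g; rewrite BC; apply/forallP=> x.
  by have := cBC (p^-1%g x); rewrite permKV eq_sym.
have tr (B C D : colored_digraph T) :
    bicolored_iso B C -> bicolored_iso C D -> bicolored_iso B D.
  case/existsP=> p /andP[BC /forallP cBC] /existsP[q /andP[CD /forallP cCD]].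
  apply/existsP; exists (p * q)%g; rewrite (is_isoM BC CD); apply/forallP=> x.
  by rewrite permM -(eqP (cBC x)) cCD.
move=> B C D; split.
  by apply/existsP; exists 1%g; rewrite is_iso1; apply/forallP=> x; rewrite perm1.
by move=> BC; apply/idP/idP; apply: tr => //; apply: sym.
Qed.

(* Main.v *)
Require Import Defs.
From mathcomp Require Import all_boot all_order all_fingroup all_algebra.
From mathcomp Require Import zify.

(** Write [s_n] and [b_n] for the numbers of unlabeled split and bicolored graphs.
    Turning the green vertices of a bicolored graph into a clique gives every
    split graph, so [s_n <= b_n].  On the bicolored graphs in which every green
    vertex has a red neighbour this map is injective up to isomorphism, and a
    bicolored graph with an isolated green vertex is determined by what remains
    after deleting that vertex; hence [b_(n+1) <= s_(n+1) + b_n].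

    It remains to see that [b_n = o(b_(n+1))].  Dividing the number of labeled
    graphs by [n!] gives [2^(gr) <= g! r! b_n] for [g + r = n].  Conversely, view
    a bicolored graph with color classes of sizes [a >= r] as a 0-1 matrix with
    [a] rows: keep the first [k] rows, sort the columns by their [k] bits there,
    then sort the remaining rows.  This leaves at most
    [C(r + 2^k - 1, r) C(a - k + 2^r - 1, a - k)] matrices, which for
    [k ~ 2 log n] exceeds [2^(ar) / (a! r!)] by a factor [O(n^k)] only, whereas
    passing from [r] to [r + 1] multiplies the lower bound by [2^a / (r + 1)]. *)

Set Implicit Arguments.
Unset Strict Implicit.
Unset Printing Implicit Defensive.

(** * Counting equivalence classes *)

Notation num_classes R D := #|equivalence_partition R D|.

Lemma card_unrelated_le (T : finType) (R : rel T) (D V : {set T}) :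
  equivalence_rel R -> V \subset D ->
  {in V &, forall x y, R x y -> x = y} -> #|V| <= num_classes R D.
Proof.
move=> eqR sVD V1; pose f x := [set y in D | R x y].
have injf : {in V &, injective f}.
  move=> x y xV yV fxy; apply: V1 => //.
  have: y \in f y by rewrite inE (subsetP sVD) //= (eqR y y y).1.
  by rewrite -fxy inE => /andP[].
by rewrite -(card_in_imset injf) subset_leq_card // imsetS.
Qed.

Lemma exists_representatives (T : finType) (R : rel T) (D : {set T}) :
  equivalence_rel R -> exists2 U : {set T}, U \subset D &
    #|U| = num_classes R D /\ {in U &, forall x y, R x y -> x = y}.
Proof.
move=> eqR; have eqRD : {in D & &, equivalence_rel R} by move=> x y z *; apply: eqR.
have partP := equivalence_partitionP eqRD.
have trX := transversalP partP.
exists (transversal (equivalence_partition R D) D).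
  exact: transversal_sub trX.
split; first exact: card_transversal trX.
move=> x y xU yU Rxy; apply: (pblock_inj trX) => //.
have sU := subsetP (transversal_sub trX).
apply/eqP; rewrite eq_pblock ?(cover_partition partP) ?sU //.
  by rewrite pblock_equivalence_partition ?sU.
by case/and3P: partP.
Qed.

(** Each fibre of [f] on [D] lies inside one class, so [f] is injective on a set of
    representatives. *)
Lemma num_classes_le_card (T C : finType) (R : rel T) (D : {set T})
    (E : {set C}) (f : T -> C) :
  equivalence_rel R -> {in D, forall x, f x \in E} ->
  {in D &, forall x y, f x = f y -> R x y} -> num_classes R D <= #|E|.
Proof.
move=> eqR fE fR; have [U /subsetP sUD [<- U1]] := exists_representatives D eqR.
have injf : {in U &, injective f}.
  by move=> x y xU yU fxy; apply: U1 => //; apply: fR; rewrite ?sUD.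
rewrite -(card_in_imset injf) subset_leq_card //.
by apply/subsetP=> _ /imsetP[x xU ->]; rewrite fE ?sUD.
Qed.

Lemma num_classes_le (T1 T2 : finType) (R1 : rel T1) (R2 : rel T2)
    (D1 : {set T1}) (D2 : {set T2}) (f : T1 -> T2) :
  equivalence_rel R1 -> equivalence_rel R2 -> {in D1, forall x, f x \in D2} ->
  {in D1 &, forall x y, R2 (f x) (f y) -> R1 x y} ->
  num_classes R1 D1 <= num_classes R2 D2.
Proof.
move=> eqR1 eqR2 fD fR.
(* Each [x] is sent to the whole [R2]-class of [f x], so that equal images mean related values of
   [f]. *)
apply: (@num_classes_le_card _ _ _ _ _ (fun x => [set y in D2 | R2 (f x) y])) => //.
  by move=> x xD; apply: imset_f; apply: fD.
move=> x y xD yD exy; apply: fR => //.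
have: f y \in [set z in D2 | R2 (f y) z] by rewrite inE fD //= (eqR2 (f y) (f y) (f y)).1.
by rewrite -exy inE => /andP[].
Qed.

(** The sets [F i] may overlap and may cut through classes: representatives of [D] that fall into
    the same [F i] are still pairwise unrelated there. *)
Lemma num_classes_bigcup (T I : finType) (R : rel T) (D : {set T})
    (P : pred I) (F : I -> {set T}) :
  equivalence_rel R -> D \subset \bigcup_(i | P i) F i ->
  num_classes R D <= \sum_(i | P i) num_classes R (F i).
Proof.
move=> eqR sDF; have [U sUD [<- U1]] := exists_representatives D eqR.
have -> : U = \bigcup_(i | P i) (U :&: F i).
  apply/setP=> x; apply/idP/bigcupP => [xU|[i _ /setIP[]//]].
  have /bigcupP[i Pi xF] := subsetP sDF x (subsetP sUD x xU).
  by exists i => //; rewrite inE xU.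
apply: leq_trans (_ : \sum_(i | P i) #|U :&: F i| <= _).
  elim/big_rec2: _ => [|i n A _ IH]; first by rewrite cards0.
  by rewrite (leq_trans _ (leq_add (leqnn _) IH)) // cardsU leq_subr.
apply: leq_sum => i _; apply: card_unrelated_le; rewrite ?subsetIr //.
by move=> x y /setIP[xU _] /setIP[yU _]; apply: U1.
Qed.

Lemma card_le_num_classes (T : finType) (R : rel T) (D : {set T}) (M : nat) :
  equivalence_rel R -> {in D, forall x, #|[set y in D | R x y]| <= M} ->
  #|D| <= num_classes R D * M.
Proof.
move=> eqR leM; have eqRD : {in D & &, equivalence_rel R} by move=> x y z *; apply: eqR.
rewrite (card_partition (equivalence_partitionP eqRD)) -sum_nat_const.
by apply: leq_sum => _ /imsetP[x xD ->]; apply: leM.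
Qed.

(** * Split graphs and bicolored graphs *)

Lemma is_isoP (T : finType) (G H : digraph T) (p : {perm T}) :
  reflect (forall x y, adj H (p x) (p y) = adj G x y) (is_iso G H p).
Proof.
apply: (iffP forallP) => [GH x y|GH x]; first by have /forallP/(_ y)/eqP := GH x.
by apply/forallP=> y; rewrite GH.
Qed.

Lemma bicolored_isoP (T : finType) (B C : colored_digraph T) :
  reflect (exists2 p : {perm T}, is_iso B.1 C.1 p & forall x, C.2 (p x) = B.2 x)
          (bicolored_iso B C).
Proof.
apply: (iffP existsP) => [[p /andP[BC /forallP cBC]]|[p BC cBC]]; exists p => //.
  by move=> x; apply/eqP.
by rewrite BC; apply/forallP=> x; rewrite cBC.
Qed.

Lemma bicoloredP (T : finType) (B : colored_digraph T) :
  reflect (symmetric (adj B.1) /\ forall x y, adj B.1 x y -> B.2 x != B.2 y)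
          (bicolored_graph B).
Proof.
apply: (iffP andP) => [[/andP[_ /forallP sB] /forallP cB]|[sB cB]]; split.
- by move=> x y; have /forallP/(_ y)/eqP := sB x.
- by move=> x y; have /forallP/(_ y)/implyP := cB x.
- apply/andP; split; apply/forallP=> x; last by apply/forallP=> y; rewrite sB.
  by apply/negP=> /cB; rewrite eqxx.
- by apply/forallP=> x; apply/forallP=> y; apply/implyP; apply: cB.
Qed.

Definition fill (T : finType) (B : colored_digraph T) : digraph T :=
  [ffun xy => (xy.1 != xy.2) && (adj B.1 xy.1 xy.2 || B.2 xy.1 && B.2 xy.2)].

Lemma adj_fill (T : finType) (B : colored_digraph T) (x y : T) :
  adj (fill B) x y = (x != y) && (adj B.1 x y || B.2 x && B.2 y).
Proof. by rewrite /adj ffunE. Qed.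

Lemma fill_simple (T : finType) (B : colored_digraph T) :
  bicolored_graph B -> simple_graph (fill B).
Proof.
case/bicoloredP=> sB _; apply/andP; split; apply/forallP=> x.
  by rewrite adj_fill eqxx.
by apply/forallP=> y; rewrite !adj_fill (eq_sym y x) (sB y) [B.2 y && _]andbC.
Qed.

Lemma fill_split (T : finType) (B : colored_digraph T) :
  bicolored_graph B -> split_graph (fill B).
Proof.
move=> bB; have [_ cB] := bicoloredP _ bB.
rewrite /split_graph fill_simple //=.
apply/existsP; exists [set x | B.2 x]; apply/existsP; exists (~: [set x | B.2 x]).
rewrite setUCr setICr !eqxx /=; apply/andP; split.
  apply/forall_inP=> x; rewrite inE => cx; apply/forall_inP=> y; rewrite inE => cy.
  by rewrite adj_fill cx cy orbT andbT implybb.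
apply/forall_inP=> x; rewrite !inE => /negbTE cx.
apply/forall_inP=> y; rewrite !inE => /negbTE cy.
by rewrite adj_fill cx cy orbF; apply/nandP; right; apply/negP => /cB; rewrite cx cy.
Qed.

Lemma fill_iso (T : finType) (B C : colored_digraph T) :
  bicolored_iso B C -> graph_iso (fill B) (fill C).
Proof.
case/bicolored_isoP=> p /is_isoP BC cBC; apply/existsP; exists p.
by apply/is_isoP=> x y; rewrite !adj_fill BC !cBC (inj_eq perm_inj).
Qed.

(** [fill] adds only edges between green vertices, while the edges of [B] join different colors; so
    [B] can be read off from [fill B] and its coloring. *)
Lemma adj_fill_bicolored (T : finType) (B : colored_digraph T) (x y : T) :
  bicolored_graph B -> adj B.1 x y = adj (fill B) x y && (B.2 x != B.2 y).
Proof.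
case/bicoloredP=> _ cB; rewrite adj_fill; case: (boolP (adj B.1 x y)) => [/cB cxy|_].
  by rewrite cxy /= !andbT; case: (eqVneq x y) cxy => [->|//]; rewrite eqxx.
by case: (B.2 x); case: (B.2 y); rewrite /= ?andbF.
Qed.

Definition cut (T : finType) (G : digraph T) (K : {set T}) : colored_digraph T :=
  ([ffun xy => adj G xy.1 xy.2 && ((xy.1 \in K) != (xy.2 \in K))],
   [ffun x => x \in K]).

Lemma cut_bicolored (T : finType) (G : digraph T) (K : {set T}) :
  simple_graph G -> bicolored_graph (cut G K).
Proof.
case/andP=> _ /forallP sG; apply/bicoloredP; split=> x y.
  rewrite /adj !ffunE /=; have /forallP/(_ y)/eqP-> := sG x.
  by rewrite (eq_sym (x \in K)).
by rewrite /adj !ffunE /= => /andP[].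
Qed.

Lemma fill_cut (T : finType) (G : digraph T) (K : {set T}) :
  simple_graph G -> clique G K -> stable_set G (~: K) -> fill (cut G K) = G.
Proof.
case/andP=> /forallP iG _ /forall_inP cG /forall_inP tG.
apply/ffunP=> -[x y]; rewrite ffunE /= {1}/adj !ffunE /= -/(adj G x y).
case: (eqVneq x y) => [<-|xy]; first by rewrite (negbTE (iG x)).
have [xK|xK] := boolP (x \in K); have [yK|yK] := boolP (y \in K) => /=.
- by rewrite orbT; apply/esym; have /forall_inP/(_ y yK)/implyP/(_ xy) := cG x xK.
- by rewrite andbT orbF.
- by rewrite andbT orbF.
- rewrite andbF; apply/esym/negbTE; have xC : x \in ~: K by rewrite inE.
  by have /forall_inP/(_ y) := tG x xC; rewrite inE; apply.
Qed.

(** Choosing one clique [K] for every split graph makes [cut] a section of [fill]. Since [fill]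
    preserves isomorphism, this section reflects it. *)
Lemma num_split_le_bicolored n : num_split n <= num_bicolored n.
Proof.
pose good (G : digraph 'I_n) (K : {set 'I_n}) := clique G K && stable_set G (~: K).
(* The default [set0] is never reached on a split graph, which has a good [K]. *)
pose f G := cut G (odflt set0 [pick K | good G K]).
have fP : {in [set G : digraph 'I_n | split_graph G], cancel f (@fill _)}.
  move=> G; rewrite inE => /andP[sG /existsP[K /existsP[S]]].
  case/and4P=> /eqP KS /eqP KS0 cK tS.
  rewrite /f; case: pickP => [K' /andP[cK' tK']|/(_ K)]; first exact: fill_cut.
  rewrite /good cK /=; suff -> : ~: K = S by rewrite tS.
  apply/setP=> x; move/setP/(_ x): KS; move/setP/(_ x): KS0; rewrite !inE.
  by case: (x \in K); case: (x \in S).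
apply: (num_classes_le (f := f)); [exact: graph_iso_equiv | exact: bicolored_iso_equiv | |].
  by move=> G; rewrite !inE => /andP[sG _]; apply: cut_bicolored.
by move=> G H GD HD /fill_iso; rewrite !fP.
Qed.

(** * Uniqueness of tight colorings up to automorphism *)

Section Swing.

Variables (T : finType) (E : rel T).
Hypothesis E_sym : symmetric E.
Hypothesis E_irr : irreflexive E.

(** These are the split partitions whose red side is a maximum stable set: a stable set has at most
    one green vertex, and then misses a red neighbour of it. *)
Definition tight_coloring (c : T -> bool) :=
  [/\ forall x y, c x -> c y -> x != y -> E x y,
      forall x y, ~~ c x -> ~~ c y -> ~~ E x y
    & forall x, c x -> exists2 y, ~~ c y & E x y].

(* A vertex that is green only for [c] and a red neighbour of it are twins, and
   [c] and [d] differ only on them. *)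
Lemma tight_coloring_swap (c d : T -> bool) (v : T) :
  tight_coloring c -> tight_coloring d -> c v -> ~~ d v ->
  exists q : {perm T}, [/\ forall x y, E (q x) (q y) = E x y,
    involutive q & forall x, d (q x) = c x].
Proof.
move=> [Kc Sc Nc] [Kd Sd Nd] cv dv; have [w cw vw] := Nc v cv.
have dw : d w by apply: contraLR vw => dw; apply: Sd.
(* A vertex green only for [d] would be joined to [w] inside the clique of [d], though both are red
   for [c]. A vertex green only for [c] would likewise be joined to [v], though both are red for
   [d]. *)
have cdE x : x != v -> x != w -> d x = c x.
  move=> xv xw; apply/idP/idP => [dx|cx].
    by apply: contraT => cx; have := Sc x w cx cw; rewrite Kd.
  by apply: contraT => dx; have := Sd x v dx dv; rewrite Kc.
have vwE x : x != v -> x != w -> E v x = E w x.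
  move=> xv xw; case: (boolP (c x)) => cx.
    have [vx wx] : v != x /\ w != x by rewrite ![_ == x]eq_sym.
    by rewrite (Kc v x) // (Kd w x) // cdE.
  have dx : ~~ d x by rewrite cdE.
  by rewrite (negbTE (Sd v x dv dx)) (negbTE (Sc w x cw cx)).
exists (tperm v w); split.
- move=> x y.
  case: tpermP => [->|->|/eqP xv /eqP xw]; case: tpermP => [->|->|/eqP yv /eqP yw];
    by rewrite ?E_irr ?(E_sym w v) // ?vwE // !(E_sym x) vwE.
- exact: tpermK.
- move=> x; case: tpermP => [->|->|/eqP xv /eqP xw]; last exact: cdE.
    by rewrite dw cv.
  by rewrite (negbTE dv) (negbTE cw).
Qed.

Lemma tight_coloring_transport (c d : T -> bool) :
  tight_coloring c -> tight_coloring d ->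
  exists q : {perm T},
    (forall x y, E (q x) (q y) = E x y) /\ (forall x, d (q x) = c x).
Proof.
move=> tc td; have [/forallP cd|] := boolP [forall x, c x == d x].
  exists 1%g; split=> x => [y|]; rewrite !perm1 //.
  exact/esym/eqP.
rewrite negb_forall => /existsP[v]; case cv : (c v); case dv : (d v) => // _.
  have [q [qE _ qd]] := tight_coloring_swap tc td cv (negbT dv).
  by exists q.
(* The roles of [c] and [d] are exchanged here; the resulting [q] still serves because it is an
   involution. *)
have [q [qE qK qd]] := tight_coloring_swap td tc dv (negbT cv).
by exists q; split=> // x; rewrite -qd qK.
Qed.

End Swing.

Definition has_isolated_green (T : finType) (B : colored_digraph T) : bool :=
  [exists v, B.2 v && [forall x, ~~ adj B.1 v x]].

Lemma fill_tight (T : finType) (B : colored_digraph T) :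
  bicolored_graph B -> ~~ has_isolated_green B ->
  tight_coloring (adj (fill B)) B.2.
Proof.
move=> bB; have [_ cB] := bicoloredP _ bB.
rewrite negb_exists => /forallP nB; split.
- by move=> x y cx cy xy; rewrite adj_fill xy cx cy orbT.
- move=> x y /negbTE cx /negbTE cy; rewrite adj_fill cx cy orbF.
  by apply/nandP; right; apply/negP => /cB; rewrite cx cy.
move=> x cx; have := nB x; rewrite cx /= negb_forall => /existsP[y /negPn xy].
exists y; first by have := cB _ _ xy; rewrite cx; case: (B.2 y).
by have := xy; rewrite (adj_fill_bicolored _ _ bB) => /andP[].
Qed.

(** Pulling the coloring of [C] back along [p] gives a second tight coloring of [fill B]. An
    automorphism [q] of [fill B] carries one to the other, so [q] followed by [p] respects colors,
    hence also the original edges. *)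
Lemma fill_reflects_iso (T : finType) (B C : colored_digraph T) :
  bicolored_graph B -> bicolored_graph C ->
  ~~ has_isolated_green B -> ~~ has_isolated_green C ->
  graph_iso (fill B) (fill C) -> bicolored_iso B C.
Proof.
move=> bB bC nB nC /existsP[p /is_isoP pE].
have /andP[/forallP iB /forallP sB] := fill_simple bB.
have symB : symmetric (adj (fill B)) by move=> x y; have /forallP/(_ y)/eqP := sB x.
have irrB : irreflexive (adj (fill B)) by move=> x; apply/negbTE/iB.
have [Kc Sc Nc] := fill_tight bC nC.
have tight : tight_coloring (adj (fill B)) (fun x => C.2 (p x)).
  split=> [x y cx cy xy|x y cx cy|x cx]; rewrite -?pE.
  - by apply: Kc => //; rewrite (inj_eq perm_inj).
  - exact: Sc.
  have [y cy xy] := Nc _ cx; exists (p^-1%g y); first by rewrite permKV.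
  by rewrite -pE permKV.
have [q [qE qc]] := tight_coloring_transport symB irrB (fill_tight bB nB) tight.
apply/bicolored_isoP; exists (q * p)%g; last by move=> x; rewrite permM qc.
apply/is_isoP=> x y.
by rewrite !permM (adj_fill_bicolored _ _ bB) (adj_fill_bicolored _ _ bC) pE qE !qc.
Qed.

(** * Deleting an isolated green vertex *)

Definition delete (n : nat) (B : colored_digraph 'I_n.+1) (v : 'I_n.+1) :
    colored_digraph 'I_n :=
  ([ffun xy => adj B.1 (lift v xy.1) (lift v xy.2)], [ffun x => B.2 (lift v x)]).

Lemma delete_bicolored (n : nat) (B : colored_digraph 'I_n.+1) (v : 'I_n.+1) :
  bicolored_graph B -> bicolored_graph (delete B v).
Proof.
case/bicoloredP=> sB cB; apply/bicoloredP; split=> x y.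
  by rewrite /adj !ffunE; apply: sB.
by rewrite /adj !ffunE; apply: cB.
Qed.

(** An isomorphism of the remainders extends by sending [v] to [w]: both are isolated, so no new
    edge has to be matched. *)
Lemma delete_reflects_iso (n : nat) (B C : colored_digraph 'I_n.+1)
    (v w : 'I_n.+1) :
  bicolored_graph B -> bicolored_graph C -> B.2 v = C.2 w ->
  (forall x, ~~ adj B.1 v x) -> (forall x, ~~ adj C.1 w x) ->
  bicolored_iso (delete B v) (delete C w) -> bicolored_iso B C.
Proof.
move=> /bicoloredP[sB _] /bicoloredP[sC _] cvw iv iw.
case/bicolored_isoP=> p /is_isoP pE pc; apply/bicolored_isoP.
exists (lift_perm v w p); last first.
  move=> x; case: (unliftP v x) => [j|] ->; last by rewrite lift_perm_id.
  by have := pc j; rewrite lift_perm_lift !ffunE.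
apply/is_isoP=> x y; case: (unliftP v x) => [i|] ->; last first.
  by rewrite lift_perm_id (negbTE (iv _)) (negbTE (iw _)).
case: (unliftP v y) => [j|] ->; last first.
  by rewrite sC sB lift_perm_id (negbTE (iv _)) (negbTE (iw _)).
by rewrite !lift_perm_lift; have := pE i j; rewrite /adj !ffunE.
Qed.

Lemma num_bicoloredS_le n : num_bicolored n.+1 <= num_split n.+1 + num_bicolored n.
Proof.
pose D := [set B : colored_digraph 'I_n.+1 | bicolored_graph B].
pose F b := [set B in D | has_isolated_green B == b].
have eqb T := @bicolored_iso_equiv T; have eqg T := @graph_iso_equiv T.
apply: leq_trans (_ : \sum_(b : bool) num_classes (@bicolored_iso _) (F b) <= _).
  apply: num_classes_bigcup => //; apply/subsetP=> B BD.
  by apply/bigcupP; exists (has_isolated_green B) => //; rewrite inE BD eqxx.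
rewrite big_bool addnC; apply: leq_add; last first.
  apply: (num_classes_le (f := @fill _)) => //.
    by move=> B; rewrite !inE => /andP[/fill_split].
  move=> B C; rewrite !inE => /andP[bB nB] /andP[bC nC].
  by apply: fill_reflects_iso => //; rewrite -eqbF_neg.
pose iso (B : colored_digraph 'I_n.+1) v := B.2 v && [forall x, ~~ adj B.1 v x].
(* On [F true] an isolated green vertex exists, so the default [ord0] is not reached. *)
pose f B := delete B (odflt ord0 [pick v | iso B v]).
have fP B : B \in F true -> let v := odflt ord0 [pick v | iso B v] in
    bicolored_graph B /\ iso B v.
  rewrite !inE => /andP[bB /eqP/existsP[v iv]]; split=> //.
  by case: pickP => [//|/(_ v)]; rewrite /iso iv.
apply: (num_classes_le (f := f)) => //.
  by move=> B /fP[bB _]; rewrite inE delete_bicolored.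
move=> B C /fP[bB /andP[gv /forallP iv]] /fP[bC /andP[gw /forallP iw]].
by apply: delete_reflects_iso => //; rewrite gv gw.
Qed.

(** * Lower bound *)

(** A labeled bicolored graph is coded by its green set and its edges, each oriented from green to
    red; this makes the count a product. *)
Definition join_cut (T : finType) (AE : {set T} * {set T * T}) : colored_digraph T :=
  ([ffun xy => (xy \in AE.2) || ((xy.2, xy.1) \in AE.2)], [ffun x => x \in AE.1]).

Definition cut_edges (T : finType) (g : nat) : {set {set T} * {set T * T}} :=
  [set AE : {set T} * {set T * T} | (#|AE.1| == g) && (AE.2 \subset setX AE.1 (~: AE.1))].

Lemma card_cut_edges (T : finType) (g : nat) :
  #|cut_edges T g| = 'C(#|T|, g) * 2 ^ (g * (#|T| - g)).
Proof.
rewrite -sum1_card (eq_bigl (fun AE : {set T} * {set T * T} =>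
    (#|AE.1| == g) && (AE.2 \subset setX AE.1 (~: AE.1)))); last first.
  by move=> AE; rewrite inE.
rewrite -(pair_big_dep (fun A : {set T} => #|A| == g)
    (fun (A : {set T}) (E : {set T * T}) => E \subset setX A (~: A)) (fun _ _ => 1)) /=.
rewrite -card_draws -sum_nat_const.
rewrite [RHS](eq_bigl (fun A : {set T} => #|A| == g)); last by move=> A; rewrite inE.
apply: eq_bigr => A /eqP gA.
have <- : #|powerset (setX A (~: A))| = 2 ^ (g * (#|T| - g)).
  by rewrite card_powerset cardsX [#|~: A|]cardsCs setCK gA.
by rewrite sum1dep_card; apply: eq_card => E; rewrite !inE.
Qed.

Lemma join_cut_bicolored (T : finType) (g : nat) :
  {in cut_edges T g, forall AE, bicolored_graph (join_cut AE)}.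
Proof.
move=> [A E]; rewrite inE => /andP[_ /= /subsetP sE]; apply/bicoloredP; split=> x y.
  by rewrite /adj !ffunE orbC.
rewrite /adj !ffunE /= => /orP[] /sE; rewrite !inE /= => /andP[].
  by move=> ->.
by move=> -> /negbTE->.
Qed.

Lemma join_cut_inj (T : finType) (g : nat) : {in cut_edges T g &, injective (@join_cut T)}.
Proof.
move=> [A E] [A' E']; rewrite !inE /= => /andP[_ /subsetP sE] /andP[_ /subsetP sE'].
case=> /ffunP eE /ffunP eA; have AA' : A = A'.
  by apply/setP=> x; have := eA x; rewrite !ffunE.
rewrite -{}AA' in sE' *; congr pair; apply/setP=> -[x y].
(* The colors of the endpoints determine the orientation, so symmetrizing the edge set loses
   nothing. *)
have half (F : {set T * T}) : {subset F <= setX A (~: A)} ->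
    ((x, y) \in F) = [&& x \in A, y \notin A & ((x, y) \in F) || ((y, x) \in F)].
  move=> sF; have [/sF|_] := boolP ((x, y) \in F); first by rewrite !inE => /andP[-> ->].
  by have [/sF|_] := boolP ((y, x) \in F); rewrite ?andbF // !inE => /andP[-> _]; rewrite andbF.
by rewrite (half E sE) (half E' sE'); have := eE (x, y); rewrite !ffunE /= => ->.
Qed.

Definition relabel (T : finType) (B : colored_digraph T) (p : {perm T}) :
    colored_digraph T :=
  ([ffun xy => adj B.1 (p xy.1) (p xy.2)], [ffun x => B.2 (p x)]).

Lemma card_bicolored_class (T : finType) (D : {set colored_digraph T}) B :
  #|[set C in D | bicolored_iso B C]| <= #|T|`!.
Proof.
have <- : #|[set: {perm T}]| = #|T|`!.
  by rewrite -[in RHS]cardsT -card_perm; apply: eq_card => p; rewrite !inE; apply/esym/subsetP.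
apply: leq_trans (leq_imset_card (fun p : {perm T} => relabel B p) _).
apply/subset_leq_card/subsetP=> C; rewrite inE => /andP[_ /bicolored_isoP[p /is_isoP pE pc]].
apply/imsetP; exists p^-1%g => //; case: C pE pc => G c /= pE pc; congr pair.
  by apply/ffunP=> -[x y]; rewrite ffunE /= -pE !permKV.
by apply/ffunP=> x; rewrite ffunE -pc permKV.
Qed.

(** Multiplied by ['C(n, g)], the left side counts the labeled bicolored graphs with [g] green
    vertices and the right side becomes [n!] times the number of classes, each of which has at most
    [n!] members. *)
Lemma num_bicolored_ge n g : g <= n ->
  2 ^ (g * (n - g)) <= g`! * (n - g)`! * num_bicolored n.
Proof.
move=> gn; rewrite -(leq_pmul2l (m := 'C(n, g))) ?bin_gt0 //.
rewrite mulnA bin_fact // mulnC.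
have -> : 2 ^ (g * (n - g)) * 'C(n, g) = #|cut_edges 'I_n g|.
  by rewrite card_cut_edges card_ord mulnC.
rewrite -(card_in_imset (@join_cut_inj _ g)) mulnC.
pose D := [set B : colored_digraph 'I_n | bicolored_graph B].
apply: leq_trans (subset_leq_card _) (card_le_num_classes (D := D) _ _).
- by apply/subsetP=> _ /imsetP[AE AEg ->]; rewrite inE (join_cut_bicolored AEg).
- exact: bicolored_iso_equiv.
by move=> B _; rewrite (leq_trans (card_bicolored_class _ _)) ?card_ord.
Qed.

(** * Upper bound *)

Fixpoint bits (s : seq bool) : nat := if s is b :: s' then b + (bits s').*2 else 0.

Lemma bits_lt s : bits s < 2 ^ size s.
Proof. by elim: s => //= b s IH; rewrite expnS; case: b => /=; lia. Qed.

Lemma bits_inj s t : size s = size t -> bits s = bits t -> s = t.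
Proof.
elim: s t => [|b s IH] [|b' t] //= [st] e.
suff [-> e'] : b = b' /\ bits s = bits t by rewrite (IH t).
by case: b b' e => -[] /=; lia.
Qed.

(** Lists of bounded numbers are repackaged as tuples of ordinals so that [card_sorted_tuples] can
    count the sorted ones. *)
Definition ord_code (r N : nat) (l : seq nat) : r.-tuple 'I_N.+1 :=
  [tuple inord (nth 0 l i) | i < r].

Lemma ord_codeK r N l : size l = r -> all (fun x => x < N.+1) l ->
  map val (ord_code r N l) = l.
Proof.
move=> sl /all_nthP lN; apply: (@eq_from_nth _ 0); rewrite size_map size_tuple //.
move=> i ir; rewrite (nth_map ord0) ?size_tuple //.
by rewrite -[i]/(val (Ordinal ir)) -tnth_nth tnth_mktuple /= inordK // lN ?sl.
Qed.

(** * Encoding a bicolored graph by two sorted lists *)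

Section Code.

Variables (T : finType) (c : bool) (k : nat) (B : colored_digraph T).

(** The vertices of color [c] index the rows of the matrix, the others its columns. *)
Definition part (b : bool) : seq T := [seq x <- enum T | (B.2 x == c) == b].
Definition fixed_rows := take k (part true).
Definition column_key (y : T) := bits [seq adj B.1 x y | x <- fixed_rows].
Definition columns := sort (relpre column_key leq) (part false).
Definition row_key (x : T) := bits [seq adj B.1 x y | y <- columns].
Definition rows := sort (relpre row_key leq) (drop k (part true)).
Definition arrangement := fixed_rows ++ rows ++ columns.
(** The two codes are not invariants of the isomorphism class, since the fixed rows depend on the
    labeling. They do record the whole matrix in the order of [arrangement]: the fixed rows in the
    column keys, the other rows in the row keys. *)
Definition column_code := map column_key columns.
Definition row_code := map row_key rows.

Lemma sorted_column_code : sorted leq column_code.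
Proof. by rewrite sorted_map sort_sorted // => x y; apply: leq_total. Qed.

Lemma sorted_row_code : sorted leq row_code.
Proof. by rewrite sorted_map sort_sorted // => x y; apply: leq_total. Qed.

Lemma perm_arrangement : perm_eq arrangement (enum T).
Proof.
rewrite perm_sym -(perm_filterC (fun x => (B.2 x == c) == true) (enum T)) perm_sym.
rewrite /arrangement catA perm_cat //.
  by rewrite -[X in perm_eq _ X](cat_take_drop k) perm_cat2l perm_sort.
rewrite perm_sort /part (_ : filter _ _ = [seq x <- enum T | (B.2 x == c) == false]) //.
by apply: eq_filter => x /=; case: (_ == c).
Qed.

Lemma size_part_true : size (part true) = #|[set x | B.2 x == c]|.
Proof.
rewrite cardsE cardE /enum_mem size_filter /part size_filter enumT.
by apply: eq_count => x /=; rewrite eqb_id.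
Qed.

Lemma size_rows : size rows = #|[set x | B.2 x == c]| - k.
Proof. by rewrite size_sort size_drop size_part_true. Qed.

Lemma size_fixed_rows : k <= #|[set x | B.2 x == c]| -> size fixed_rows = k.
Proof. by move=> kA; rewrite size_takel ?size_part_true. Qed.

Lemma size_columns : size columns = #|T| - #|[set x | B.2 x == c]|.
Proof.
have := perm_size perm_arrangement; rewrite !size_cat -cardT.
rewrite size_rows size_take size_part_true.
move: #|[set _ | _]| #|T| (size _) => a t m; case: ltnP; lia.
Qed.

Lemma fixed_rows_color x : x \in fixed_rows -> B.2 x == c.
Proof. by move/mem_take; rewrite mem_filter eqb_id => /andP[]. Qed.

Lemma rows_color x : x \in rows -> B.2 x == c.
Proof. by rewrite mem_sort => /mem_drop; rewrite mem_filter eqb_id => /andP[]. Qed.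

Lemma columns_color y : y \in columns -> B.2 y != c.
Proof. by rewrite mem_sort mem_filter eqbF_neg => /andP[]. Qed.

End Code.

Lemma nth_arrangement (T : finType) (c : bool) (k a i : nat)
    (B : colored_digraph T) (x0 : T) :
  #|[set x | B.2 x == c]| = a -> k <= a ->
  nth x0 (arrangement c k B) i =
    if i < k then nth x0 (fixed_rows c k B) i
    else if i < a then nth x0 (rows c k B) (i - k)
    else nth x0 (columns c k B) (i - a).
Proof.
move=> aE ka; rewrite !nth_cat size_fixed_rows ?aE // size_rows aE.
case: ltnP => // ki; rewrite ltn_sub2rE // ; case: ltnP => // ai.
by congr (nth _ _ _); lia.
Qed.

(* The colour of a vertex and its adjacencies are functions of its position in
   the arrangement, and the codes determine these functions. *)
Lemma same_code_iso (T : finType) (c : bool) (k : nat) (B C : colored_digraph T) :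
  bicolored_graph B -> bicolored_graph C ->
  #|[set x | B.2 x == c]| = #|[set x | C.2 x == c]| ->
  k <= #|[set x | B.2 x == c]| ->
  column_code c k B = column_code c k C -> row_code c k B = row_code c k C ->
  bicolored_iso B C.
Proof.
move=> /bicoloredP[sB cB] /bicoloredP[sC cC] eqBC; set a := #|_| in eqBC *.
move=> ka ecol erow.
(* A vertex [x0] serves as default for [nth]; on an empty [T] the identity is an isomorphism. *)
have [x0 _|T0] := pickP (mem T); last first.
  apply/bicolored_isoP; exists 1%g; last by move=> x; have := T0 x.
  by apply/is_isoP=> x; have := T0 x.
pose s := arrangement c k B; pose t := arrangement c k C.
have ps : perm_eq s (enum T) := perm_arrangement c k B.
have pt : perm_eq t (enum T) := perm_arrangement c k C.
have uS : uniq s by rewrite (perm_uniq ps) enum_uniq.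
have uT : uniq t by rewrite (perm_uniq pt) enum_uniq.
have sst : size s = size t by rewrite (perm_size ps) (perm_size pt).
have in_s x : x \in s by rewrite (perm_mem ps) mem_enum.
have idx x : index x s < size t by rewrite -sst index_mem.
pose h x := nth x0 t (index x s).
have h_inj : injective h.
  move=> x y /eqP; rewrite nth_uniq // => /eqP exy.
  by rewrite -(nth_index x0 (in_s x)) exy nth_index.
have szs : size s = #|T| by rewrite (perm_size ps) -cardT.
have szrB : size (rows c k B) = a - k by rewrite size_rows.
have szrC : size (rows c k C) = a - k by rewrite size_rows -eqBC.
have szcB : size (columns c k B) = #|T| - a by rewrite size_columns.
have szcC : size (columns c k C) = #|T| - a by rewrite size_columns -eqBC.
have szfB : size (fixed_rows c k B) = k by rewrite size_fixed_rows.
have szfC : size (fixed_rows c k C) = k by rewrite size_fixed_rows -?eqBC.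
have aT : a <= #|T| by rewrite max_card.
have nB i : nth x0 s i = _ := nth_arrangement i x0 (erefl a) ka.
have nC i : nth x0 t i = _ := nth_arrangement i x0 (esym eqBC) ka.
have colB i : i < #|T| -> (B.2 (nth x0 s i) == c) = (i < a).
  move=> iT; rewrite nB; case: ltnP => ki.
    by rewrite (fixed_rows_color (mem_nth _ _)) ?szfB // (leq_trans ki).
  case: ltnP => ai; first by rewrite (rows_color (mem_nth _ _)) // szrB ltn_sub2rE.
  by apply/negbTE/(columns_color (k := k))/mem_nth; rewrite szcB ltn_sub2rE.
have colC i : i < #|T| -> (C.2 (nth x0 t i) == c) = (i < a).
  move=> iT; rewrite nC; case: ltnP => ki.
    by rewrite (fixed_rows_color (mem_nth _ _)) ?szfC // (leq_trans ki).
  case: ltnP => ai; first by rewrite (rows_color (mem_nth _ _)) // szrC ltn_sub2rE.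
  by apply/negbTE/(columns_color (k := k))/mem_nth; rewrite szcC ltn_sub2rE.
(* For [i < k] the entry is bit [i] of the key of column [j - a]; otherwise it is bit [j - a] of the
   key of row [i - k]. *)
have adjE i j : i < a -> a <= j -> j < #|T| ->
    adj B.1 (nth x0 s i) (nth x0 s j) = adj C.1 (nth x0 t i) (nth x0 t j).
  move=> ia aj jT; rewrite !(nB j, nC j) ltnNge (leq_trans ka aj) /= ltnNge aj /=.
  have jcB : j - a < size (columns c k B) by rewrite szcB ltn_sub2rE.
  have jcC : j - a < size (columns c k C) by rewrite szcC ltn_sub2rE.
  rewrite nB nC; case: ltnP => ik.
    have := congr1 (nth 0 ^~ (j - a)) ecol; rewrite !(nth_map x0) //.
    move/bits_inj; rewrite !size_map szfB szfC => /(_ erefl).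
    by move/(congr1 (nth false ^~ i)); rewrite !(nth_map x0) ?szfB ?szfC.
  rewrite ia; have := congr1 (nth 0 ^~ (i - k)) erow.
  rewrite !(nth_map x0) ?szrB ?szrC ?ltn_sub2rE //.
  move/bits_inj; rewrite !size_map szcB szcC => /(_ erefl).
  by move/(congr1 (nth false ^~ (j - a))); rewrite !(nth_map x0).
have same (D : colored_digraph T) x y :
    (forall x y, adj D.1 x y -> D.2 x != D.2 y) ->
    (D.2 x == c) = (D.2 y == c) -> adj D.1 x y = false.
  move=> cD exy; apply/negP=> /cD.
  by case: (D.2 x) exy; case: (D.2 y); case: (c).
apply/bicolored_isoP; exists (perm h_inj); last first.
  move=> x; have ix : index x s < #|T| by rewrite -szs index_mem.
  have := colB _ ix; have := colC _ ix; rewrite permE /h nth_index // => <-.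
  by case: (C.2 _); case: (B.2 x); case: (c).
apply/is_isoP=> x y; rewrite !permE /h.
rewrite -{2}(nth_index x0 (in_s x)) -{2}(nth_index x0 (in_s y)).
have: index x s < #|T| by rewrite -szs index_mem.
have: index y s < #|T| by rewrite -szs index_mem.
move: (index x s) (index y s) => i j jT iT.
have [ia|ai] := ltnP i a; have [ja|aj] := ltnP j a.
- by rewrite !same // ?colB ?colC // ?ia ?ja.
- by rewrite adjE.
- by rewrite sB sC adjE.
- by rewrite !same // ?colB ?colC // ltnNge ai ltnNge aj.
Qed.

(** The first factor counts multisets of [n - a] column keys below [2 ^ k], the second multisets of
    [a - k] row keys below [2 ^ (n - a)]. The predecessors come from ordinals of type ['I_N.+1]. *)
Lemma num_classes_majority_le (n : nat) (c : bool) (a k : nat) : k <= a ->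
  num_classes (@bicolored_iso 'I_n)
    [set B | bicolored_graph B & #|[set x | B.2 x == c]| == a] <=
  'C(n - a + (2 ^ k).-1, n - a) * 'C(a - k + (2 ^ (n - a)).-1, a - k).
Proof.
move=> ka; set D := [set B | _ & _].
rewrite -(card_sorted_tuples (n - a)) -(card_sorted_tuples (a - k)) -cardsX.
pose f (B : colored_digraph 'I_n) :=
  (ord_code (n - a) (2 ^ k).-1 (column_code c k B),
   ord_code (a - k) (2 ^ (n - a)).-1 (row_code c k B)).
have fK B : B \in D ->
    map val (f B).1 = column_code c k B /\ map val (f B).2 = row_code c k B.
  rewrite inE => /andP[_ /eqP aE]; rewrite !ord_codeK //.
  - by rewrite size_map size_rows aE.
  - apply/allP=> _ /mapP[x _ ->]; rewrite prednK ?expn_gt0 //.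
    by rewrite (leq_trans (bits_lt _)) // size_map size_columns aE card_ord.
  - by rewrite size_map size_columns aE card_ord.
  apply/allP=> _ /mapP[x _ ->]; rewrite prednK ?expn_gt0 //.
  by rewrite (leq_trans (bits_lt _)) // size_map size_fixed_rows ?aE.
apply: (num_classes_le_card (f := f)); first exact: bicolored_iso_equiv.
  by move=> B /fK[e1 e2]; rewrite !inE e1 e2 sorted_column_code sorted_row_code.
move=> B C BD CD [eBC1 eBC2]; have [B1 B2] := fK B BD; have [C1 C2] := fK C CD.
have := BD; have := CD; rewrite !inE => /andP[bC /eqP aC] /andP[bB /eqP aB].
apply: (@same_code_iso _ c k) => //; rewrite ?aB ?aC //.
  by rewrite -B1 -C1 /= eBC1.
by rewrite -B2 -C2 /= eBC2.
Qed.

(** Some color [c] is carried by at least half of the vertices, and there are [2 (n + 1)] pairs of a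
    color and a class size. *)
Lemma num_bicolored_le (n : nat) (M : nat) :
  (forall c a, a <= n -> n <= a.*2 -> num_classes (@bicolored_iso 'I_n)
    [set B | bicolored_graph B & #|[set x | B.2 x == c]| == a] <= M) ->
  num_bicolored n <= n.+1.*2 * M.
Proof.
move=> leM.
pose F (ca : bool * 'I_n.+1) : {set colored_digraph 'I_n} :=
  [set B | bicolored_graph B & #|[set x | B.2 x == ca.1]| == ca.2].
apply: (@leq_trans
  (\sum_(ca : bool * 'I_n.+1 | n <= ca.2.*2) num_classes (@bicolored_iso 'I_n) (F ca))).
  apply: num_classes_bigcup; first exact: bicolored_iso_equiv.
  apply/subsetP=> B; rewrite inE => bB; pose w c := #|[set x | B.2 x == c]|.
  have wn c : w c < n.+1 by rewrite ltnS -[X in _ <= X]card_ord max_card.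
  have wC : w true + w false = n.
    rewrite -[RHS]card_ord -(cardsC [set x | B.2 x == true]); congr (_ + #|pred_of_set _|).
    by apply/setP=> x; rewrite !inE; case: (B.2 x).
  have [c cn] : exists c, n <= (w c).*2.
    by have [wT|wT] := leqP (w false) (w true); [exists true | exists false]; lia.
  by apply/bigcupP; exists (c, Ordinal (wn c)) => //; rewrite inE bB /=.
apply: (@leq_trans (\sum_(ca : bool * 'I_n.+1 | n <= ca.2.*2) M)).
  by apply: leq_sum => -[c a] /= na; apply: leM; rewrite // -ltnS.
rewrite sum_nat_const leq_mul // (leq_trans (max_card _)) //.
by rewrite card_prod card_bool card_ord mul2n.
Qed.

(** * Growth *)

Lemma ffact_le_exp n k : n ^_ k <= n ^ k.
Proof.
elim: k => // k IH; rewrite ffactnSr expnSr leq_mul //; exact: leq_subr.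
Qed.

Lemma bin_fact_le p q : 'C(p + q.-1, p) * p`! <= (q + p) ^ p.
Proof.
rewrite bin_ffact (leq_trans (ffact_le_exp _ _)) //.
by case: p => // p; rewrite leq_exp2r //; lia.
Qed.

Lemma fact_le_sub_exp a k m : k <= a -> a <= m -> a`! <= (a - k)`! * m ^ k.
Proof.
move=> ka am; rewrite -(ffact_fact ka) mulnC leq_mul //.
rewrite (leq_trans (ffact_le_exp _ _)) //.
by case: (k) => // k'; rewrite leq_exp2r.
Qed.

(** [step] is Bernoulli's inequality for [(1 - y / (x + y)) ^ i], cleared of denominators. At
    [i = j] the subtracted [j * y] is at most half of [x + y]. *)
Lemma expnD_le_double x y j : 2 * j * y <= x -> (x + y) ^ j <= 2 * x ^ j.
Proof.
move=> jyx; have step i : i <= j -> (x + y) ^ i * (x + y - i * y) <= x ^ i * (x + y).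
  elim: i => [|i IH] ij; first by rewrite !expn0 !mul1n mul0n subn0.
  have /IH {}IH : i <= j by lia.
  have iyx : i.+1 * y <= x by nia.
  apply: leq_trans (_ : x * ((x + y) ^ i * (x + y - i * y)) <= _); last first.
    by rewrite expnS -mulnA leq_mul2l IH orbT.
  have -> : x + y - i.+1 * y = x - i * y by lia.
  have -> : x + y - i * y = x - i * y + y by lia.
  rewrite expnS -mulnA mulnCA [leqRHS]mulnCA. apply: leq_mul => //.
  by rewrite mulnDl mulnDr leq_add2l mulnC leq_mul ?leq_subr.
have := step j (leqnn j); have [xy0|xy0] := posnP (x + y).
  have [-> ->] : x = 0 /\ y = 0 by lia.
  by move=> _; case: (j) => // i; rewrite addn0 exp0n.
move=> le1; rewrite -(leq_pmul2r xy0) (leq_trans (_ : _ <= 2 * ((x + y) ^ j * (x + y - j * y)))) //.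
  by rewrite mulnCA leq_mul2l; apply/orP; right; lia.
by rewrite -mulnA leq_mul2l.
Qed.

Lemma num_bicoloredS_ge_balanced m l a r k U :
  m <= 2 ^ l -> 4 * l ^ 2 + 8 * l + 20 <= m -> r + a = m -> m <= a.*2 ->
  k = (2 * l).+1 -> 2 * (a - k) ^ 2 <= 2 ^ r ->
  U = 'C(r + (2 ^ k).-1, r) * 'C(a - k + (2 ^ r).-1, a - k) ->
  U * (m * m.+1.*2) <= num_bicolored m.+1.
Proof.
move=> ml lm ram ma kE ar UE; set b := num_bicolored _.
have ka : k <= a by nia.
have am : a <= m by lia.
(* Each of the two binomials costs a factor 2 over the pure power. For the columns this requires
   [2 r^2 <= 2 ^ k], which is why [k = 2 l + 1]; for the rows it is the hypothesis [ar]. *)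
have Ub : U * r`! * (a - k)`! <= 4 * 2 ^ (r * a).
  have -> : 4 * 2 ^ (r * a) = (2 * (2 ^ k) ^ r) * (2 * (2 ^ r) ^ (a - k)).
    rewrite -!expnM mulnACA -expnD; congr (_ * 2 ^ _); nia.
  have -> : U * r`! * (a - k)`! = ('C(r + (2 ^ k).-1, r) * r`!) *
      ('C(a - k + (2 ^ r).-1, a - k) * (a - k)`!) by rewrite UE; lia.
  apply: leq_mul; apply: leq_trans (bin_fact_le _ _) (expnD_le_double _).
    have rl : r <= 2 ^ l by lia.
    by rewrite kE expnS -mulnA leq_mul2l /= [2 * l]mul2n -addnn expnD leq_mul.
  by rewrite -mulnA mulnn.
(* The extra vertex joins the smaller side, which gains the factor [2 ^ a]. *)
have lower : 2 ^ (r * a) * 2 ^ a <= a`! * r.+1`! * b.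
  have := @num_bicolored_ge m.+1 a (leqW am).
  have -> : m.+1 - a = r.+1 by lia.
  by rewrite -expnD mulnS [a * r]mulnC addnC.
(* With [m <= 2 ^ l] the left side is at most [2 ^ (2 l^2 + 4 l + 5)], and the hypothesis on [m]
   gives [2 l^2 + 4 l + 10 <= m / 2 <= a]. *)
have small : 4 * (m * m.+1.*2) * m ^ k * r.+1 <= 2 ^ a.
  have mS : m.+1 <= 2 ^ l.+1 by rewrite expnS; have := expn_gt0 2 l; lia.
  apply: (@leq_trans (2 ^ 2 * (2 ^ l * 2 ^ l.+2) * 2 ^ (l * k) * 2 ^ l.+1)).
    apply: leq_mul; last by rewrite (leq_trans _ mS) // ltnS; lia.
    apply: leq_mul; last first.
      by rewrite expnM kE leq_exp2r.
    apply: leq_mul => //; apply: leq_mul => //.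
    by rewrite [2 ^ l.+2]expnS mul2n leq_double.
  rewrite -!expnD leq_exp2l // kE; nia.
have := fact_le_sub_exp ka am => fa.
have P0 : 0 < r`! * (a - k)`! * (m ^ k * r.+1).
  by rewrite !muln_gt0 !fact_gt0 expn_gt0 andbT /=; lia.
rewrite -(leq_pmul2l P0).
apply: (@leq_trans (4 * 2 ^ (r * a) * ((m * m.+1.*2) * m ^ k * r.+1))).
  rewrite [leqLHS](_ : _ = U * r`! * (a - k)`! * ((m * m.+1.*2) * m ^ k * r.+1)).
    by rewrite leq_mul.
  move: (m ^ k) (r`!) ((a - k)`!) (m * _) => w x y z; lia.
apply: (@leq_trans (2 ^ (r * a) * 2 ^ a)).
  rewrite mulnAC -[leqLHS]mulnC leq_mul2l; apply/orP; right.
  by rewrite mulnA mulnA.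
apply: (leq_trans lower); rewrite leq_mul2r; apply/orP; right.
rewrite factS; apply: leq_trans (leq_mul fa (leqnn _)) _.
by apply: eq_leq; move: (m ^ k) (r`!) ((a - k)`!) => x y z; lia.
Qed.

(** Here [r] is logarithmic in [m], so [U] is only [2 ^ O(m log m)], whereas equal color classes
    already give about [2 ^ (m^2 / 4)] labeled graphs. *)
Lemma num_bicoloredS_ge_unbalanced m l a r U :
  m <= 2 ^ l -> 4 * l ^ 2 + 8 * l + 20 <= m -> r + a = m ->
  2 ^ r <= 2 * m ^ 2 -> U = 'C(a + (2 ^ r).-1, a) ->
  U * (m * m.+1.*2) <= num_bicolored m.+1.
Proof.
move=> ml lm ram rm UE; set b := num_bicolored _.
have mS : m.+1 <= 2 ^ l.+1 by rewrite expnS; have := expn_gt0 2 l; lia.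
have Ub : U <= 2 ^ (l.*2.+2 * m).
  rewrite UE -[leqLHS]muln1 (leq_trans (leq_mul (leqnn _) (fact_gt0 a))) //.
  rewrite (leq_trans (bin_fact_le _ _)) // expnM.
  apply: (@leq_trans ((2 ^ l.*2.+2) ^ a)).
    case: (posnP a) => [->//|a0]; rewrite leq_exp2r //.
    have m2 : m ^ 2 <= 2 ^ l.*2 by rewrite -muln2 expnM leq_exp2r.
    have mm : m <= m ^ 2 by nia.
    rewrite 2!expnS; lia.
  by rewrite leq_pexp2l ?expn_gt0 //; lia.
have lower : 2 ^ (m.+1./2 * (m.+1 - m.+1./2)) <= 2 ^ (l.+1 * m.+1) * b.
  have hn : m.+1./2 <= m.+1 by rewrite -{2}[m.+1]odd_double_half; lia.
  rewrite (leq_trans (num_bicolored_ge hn)) // leq_mul2r; apply/orP; right.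
  apply: (@leq_trans (m.+1)`!).
    by rewrite -(bin_fact hn) leq_pmull // bin_gt0.
  by rewrite -ffactnn (leq_trans (ffact_le_exp _ _)) // expnM leq_exp2r.
rewrite -(@leq_pmul2l (2 ^ (l.+1 * m.+1))) ?expn_gt0 // (leq_trans _ lower) //.
apply: (@leq_trans (2 ^ (l.+1 * m.+1) * (2 ^ (l.*2.+2 * m) * (2 ^ l * 2 ^ l.+2)))).
  rewrite leq_mul2l; apply/orP; right; apply: leq_mul => //; apply: leq_mul => //.
  by rewrite [2 ^ l.+2]expnS mul2n leq_double.
rewrite -!expnD leq_exp2l //.
have [h1 h2] : m <= (m.+1./2).*2 /\ (m.+1./2).*2 <= m.+1.
  by have := odd_double_half m.+1; case: odd => /=; lia.
move: (m.+1./2) h1 h2 => h h1 h2.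
have q : m * m <= 4 * (h * (m.+1 - h)).
  by apply: (@leq_trans (h.*2 * (m.+1 - h).*2)); [apply: leq_mul | ]; lia.
have : m * (4 * l ^ 2 + 8 * l + 20) <= m * m by rewrite leq_mul2l lm orbT.
move=> lmm; rewrite -(leq_pmul2l (isT : 0 < 4)); apply: leq_trans q.
(* The exponents on the left add up to [3 (l + 1) (m + 1)]; the factor 4 comes from [q]. *)
suff : 12 * (l.+1 * m.+1) <= m * m by lia.
apply: leq_trans lmm; move: lm; rewrite -mulnn => lm.
(* Multiplied by [m], the summand 1 pays for [12 (l + 1) <= m]. *)
have l3 : 12 * l.+1 + 1 <= 4 * (l * l) + 8 * l + 20 by nia.
have := leq_mul (leqnn m) l3; nia.
Qed.

Lemma num_bicoloredS_ge m l :
  m <= 2 ^ l -> 4 * l ^ 2 + 8 * l + 20 <= m ->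
  m * num_bicolored m <= num_bicolored m.+1.
Proof.
move=> ml lm; set b := num_bicolored m.+1; pose d := m * m.+1.*2.
have d0 : 0 < d by rewrite /d muln_gt0; lia.
(* In [d], the factor [2 (m + 1)] is the number of cases in [num_bicolored_le] and [m] is the gain
   sought; each case then has to stay below [b %/ d]. *)
apply: (@leq_trans (d * (b %/ d))); last by rewrite mulnC leq_trunc_div.
rewrite /d -mulnA leq_mul2l; apply/orP; right; apply: num_bicolored_le => c a am ma.
rewrite leq_divRL //; pose k := (2 * l).+1.
have ram : m - a + a = m by lia.
have [ar|ra] := leqP (2 * (a - k) ^ 2) (2 ^ (m - a)).
  have ka : k <= a by rewrite /k; nia.
  apply: leq_trans (leq_mul (num_classes_majority_le _ _ ka) (leqnn _)) _.
  exact: (num_bicoloredS_ge_balanced ml lm ram ma (erefl k) ar).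
(* With few columns no row is fixed: for [k = 0] the column factor is 1. *)
apply: leq_trans (leq_mul (num_classes_majority_le _ _ (leq0n a)) (leqnn _)) _.
rewrite expn0 addn0 binn mul1n subn0.
apply: (num_bicoloredS_ge_unbalanced ml lm ram _ (erefl _)).
by apply: leq_trans (ltnW ra) _; rewrite leq_mul2l /= leq_exp2r //; lia.
Qed.

Lemma num_bicolored_growth m : 1024 <= m ->
  m * num_bicolored m <= num_bicolored m.+1.
Proof.
move=> m1024; have m1 : 1 < m by lia.
have /andP[jm ml] := up_log_bounds (isT : 1 < 2) m1.
apply: num_bicoloredS_ge ml _; apply: leq_trans (ltnW jm).
have l10 : 10 <= up_log 2 m.
  by rewrite -(leq_exp2l (m := 2)) // (leq_trans _ (up_logP _ _)).
(* With [j = l - 1], the bound [4 l^2 + 8 l + 20 <= 2 ^ j] is proved by induction from [j = 9],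
   where it reads [500 <= 512]. *)
rewrite -(prednK (n := up_log 2 m)) //; last by lia.
rewrite /=; have : 9 <= (up_log 2 m).-1 by lia.
elim: (_.-1) => // j IH; rewrite leq_eqVlt => /predU1P[<-//|].
by rewrite ltnS => j9; move: {IH}(IH j9); rewrite [2 ^ j.+1]expnS -!mulnn; nia.
Qed.

Lemma num_bicolored_gt0 n : (0 < num_bicolored n)%N.
Proof.
by have := @num_bicolored_ge n 0 (leq0n n); case: num_bicolored => //; rewrite muln0.
Qed.

(* The limit of the ratio *)
From mathcomp Require Import all_classical all_reals all_analysis.

Import Order.TTheory GRing.Theory Num.Theory.
Import numFieldNormedType.Exports.

Local Open Scope classical_set_scope.
Local Open Scope ring_scope.

Theorem theorem3p10 (R : realType) :
  ((num_split n)%:R / (num_bicolored n)%:R : R) @[n --> \oo] --> (1 : R).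
Proof.
(* After two shifts the ratio is taken at [m + 1] with [m = n + 1], so that its lower bound
   [1 - 1 / m] is exactly [1 - harmonic n]. *)
rewrite -(cvg_shiftS (fun n => (num_split n)%:R / (num_bicolored n)%:R : R)).
rewrite -(cvg_shiftS (fun n => (num_split n.+1)%:R / (num_bicolored n.+1)%:R : R)).
have lower_cvg : (1 - harmonic n : R) @[n --> \oo] --> (1 : R).
  by rewrite -[X in _ --> X]subr0; apply: cvgB; [exact: cvg_cst | exact: cvg_harmonic].
apply: (squeeze_cvgr _ lower_cvg (cvg_cst (1 : R))).
near=> n; have n1024 : (1024 <= n.+1)%N by near: n; exists 1024%N => // n /= /leqW.
set m := n.+1 in n1024 *; have bS0 := num_bicolored_gt0 m.+1.
have bS0R : 0 < (num_bicolored m.+1)%:R :> R by rewrite ltr0n.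
apply/andP; split; last by rewrite ler_pdivrMr // mul1r ler_nat num_split_le_bicolored.
(* The goal becomes [b_(m+1) <= s_(m+1) + b_(m+1) / m], where the growth bound gives
   [b_m <= b_(m+1) / m]. *)
rewrite ler_pdivlMr // mulrBl mul1r lerBlDr.
have := num_bicoloredS_le m; rewrite -(ler_nat R) natrD => /le_trans; apply.
rewrite lerD2l /harmonic /= mulrC ler_pdivlMr ?ltr0n //.
by rewrite -natrM ler_nat mulnC num_bicolored_growth.
Unshelve. all: by end_near. Qed.
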